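(* Let $\mathbf A \in \mathcal{I}_{2,0}$. Then $\mathbf A$ satisfies the following identities: (1) $(x \to 0') \to y \approx (x \to y') \to y$; (2) $x \to (0 \to x)' \approx x'$; (3) $(y \to x) \to y \approx (0 \to x) \to y$; (4) $[(x \to 0') \to y]' \approx (0 \to x) \to y'$; (5) $0 \to x \approx 0 \to (0 \to x)$; (6) $[x' \to (0 \to y)]' \approx (0 \to x) \to (0 \to y)'$; (7) $[x \to (y \to x)']' \approx (x \to y) \to x$; (8) $0 \to [(0 \to x) \to (0 \to y')'] \approx 0 \to (x \to y)$; (9) $0 \to \{(0 \to x) \to y'\} \approx x \to (0 \to y')$; (10) $0 \to (0 \to x)' \approx 0 \to x'$; (11) $0 \to (x \to y) \approx x \to (0 \to y)$; (12) $[(0 \to x) \to y] \to x \approx [(y \to x) \to (0 \to x)']'$; (13) $[\{(0 \to x) \to y\} \to x]' \approx (y \to x) \to (0 \to x)'$; (14) $(0 \to x') \to (y \to x) \approx y \to x$; (15) $x' \to (0 \to x) \approx 0 \to x$; (16) $(y \to x)' \approx (0 \to x) \to (y \to x)'$; (17) $(x \to y) \to (0 \to y)' \approx (x \to y)'$; (18) $0 \to (x' \to y)' \approx x \to (0 \to y')$; (19) $[(x \to y) \to x] \to [(y \to x) \to y] \approx x \to y$; (20) $[x \to (y \to x')] \to x \approx x' \to (y \to x')'$; (21) $x \to (y \to x') \approx y \to x'$; (22) $0 \to (x \to y')' \approx 0 \to (x' \to y)$; (23) $(x \to y) \to y' \approx y \to (x \to y)'$; (24) $x \to [(y \to z') \to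 x]' \approx (x' \to y) \to \{(0 \to z) \to x'\}$; (25) $[\{((x \to 0') \to y) \to z\} \to \{u \to ((0 \to x) \to y')\}']' \approx (z \to u) \to \{(0 \to x) \to y'\}$; (26) $(z \to x) \to (y \to z) \approx (0 \to x) \to (y \to z)$; (27) $(x' \to y) \to [(0 \to z) \to x'] \approx (0 \to y) \to [(0 \to z) \to x']$; (28) $x \to [(y \to z') \to x]' \approx (0 \to y) \to [(0 \to z) \to x']$; (29) $(x' \to y) \to (x \to y') \approx x \to y'$; (30) $(x \to y')' \to (x' \to y)' \approx x \to y'$.
   Context: An implicator groupoid is an algebra $\mathbf A = \langle A, \to, 0 \rangle$, with $\to$ binary and $0$ a constant, which, writing $x' := x \to 0$, satisfies the identities (I) $(x \to y) \to z \approx [(z' \to x) \to (y \to z)']'$ and (I$_0$) $0'' \approx 0$. $\mathcal{I}_{2,0}$ is the variety of implicator groupoids satisfying $x'' \approx x$. *)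

(* Defs.v *)
Record algebra20 : Type := Algebra20 {
  carrier :> Type;
  imp : carrier -> carrier -> carrier;
  zero : carrier
}.

Arguments imp {_} _ _.
Arguments zero {_}.

Declare Scope implicator_scope.
Delimit Scope implicator_scope with impl.

Notation "0" := zero : implicator_scope.
Notation "x ~> y" := (imp x y)
  (at level 60, no associativity) : implicator_scope.

Local Open Scope implicator_scope.

Definition neg {A : algebra20} (x : A) : A := x ~> 0.

Notation "x ^'" := (neg x)
  (at level 2, left associativity, format "x ^'") : implicator_scope.

Record implicator_groupoid (A : algebra20) : Prop := ImplicatorGroupoid {
  axiom_I : forall x y z : A,
    (x ~> y) ~> z = ((z^' ~> x) ~> (y ~> z)^')^';
  axiom_I0 : (0 : A)^'^' = 0
}.

Record in_I20 (A : algebra20) : Prop := InI20 {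
  I20_implicator : implicator_groupoid A;
  I20_involutive : forall x : A, x^'^' = x
}.

(* Main.v *)
Require Import Defs.
From Corelib Require Import ssreflect.

(** Once [x^'^' = x] holds, the defining identity says how a negation moves
    inside a nested implication: the negation of [(x ~> y) ~> z] is
    [(z^' ~> x) ~> (y ~> z)^'].  Each identity is obtained from an instance of
    this law in which one of the two brackets on the right collapses, so the
    proof is a search for brackets that collapse.

    The first ones come from putting [0] or a repeated letter into the law:
    [0^'] is a left unit ([one_imp]), [x ~> x^' = x^'] ([imp_neg_self]), and
    [(y ~> x) ~> y] does not change when the inner [y] becomes [0]
    ([imp_imp_self]).  In a De Morgan algebra, with [x ~> y] read as the join of
    [x^'] and [y], every [0 ~> x] is the top element [0^']; in general [0 ~> x]
    is a local substitute for the top element: it is left neutral for the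
    negations of implications into [x] ([neg_imp_absorb]), while [0 ~> x^'] is
    left neutral for the implications into [x] ([zero_imp_neg_absorb]).

    The turning point is [neg_imp_absorb_imp], [y^' ~> (x ~> y) = x ~> y]: an
    implication into [y] absorbs [y^'] on its left.  So the bracket [z^' ~> x] of
    the law collapses when [x] is an implication into [z], and, as a
    consequence ([neg_imp_imp_self]), also when [z] is an implication into [x].
    This gives [imp_imp_imp_zero], which replaces by [0] the [z] in the left
    factor of [(z ~> x) ~> (y ~> z)].  Together with [zero_imp_imp], which moves
    a prefix [0] past a letter, it leads to idempotence ([imp_idem]), the
    absorption law [imp_imp_swap] and a weak contraposition
    ([neg_imp_neg_imp_absorb]).

    The identity that needs a further idea is [imp_imp_imp_imp_swap].  Its two
    sides [f] and [e] are shown to have the same image under [0 ~> _], which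
    allows the exchange [e ~> f^' = f ~> e^'] ([imp_neg_comm]); and each side
    turns out to absorb the negation of the other, so that this exchange
    reads [f^' = e^']. *)

Local Open Scope implicator_scope.

Section InvolutiveImplicatorGroupoids.

Context {A : algebra20} (hA : in_I20 A).
Implicit Types x y z u : A.

(** * The distribution law and its constant instances *)

Lemma negK x : x^'^' = x.
Proof. exact: I20_involutive. Qed.

(** The two sides are the same term; the equation only lets rewriting pass
    between them. *)
Lemma imp0 x : x ~> 0 = x^'.
Proof. reflexivity. Qed.

Lemma imp_def x y z : (x ~> y) ~> z = ((z^' ~> x) ~> (y ~> z)^')^'.
Proof. exact: (axiom_I _ (I20_implicator _ hA)). Qed.

Lemma neg_imp_imp x y z : ((x ~> y) ~> z)^' = (z^' ~> x) ~> (y ~> z)^'.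
Proof. by rewrite imp_def negK. Qed.

(** With [z := 0] the law says that [0^' ~> x] and [x] cannot be told apart
    after [~> y] followed by negation; for [y := 0] these are two negations,
    which cancel. *)
Lemma one_imp x : 0^' ~> x = x.
Proof.
have neg_cancel y : ((0^' ~> x) ~> y)^' = (x ~> y)^'.
  by rewrite -[RHS]imp0 [RHS]imp_def imp0 negK.
by move: (neg_cancel 0); rewrite !imp0 !negK.
Qed.

(** The law with [0] as first letter: its bracket [x^' ~> 0] is just [x]. *)
Lemma imp_neg_imp x y : (x ~> (y ~> x)^')^' = (0 ~> y) ~> x.
Proof. by rewrite [RHS]imp_def imp0 negK. Qed.

Lemma neg_zero_imp_imp x y : ((0 ~> y) ~> x)^' = x ~> (y ~> x)^'.
Proof. by rewrite -imp_neg_imp negK. Qed.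

Lemma zero_imp_imp_one x : (0 ~> x) ~> 0^' = x ~> 0^'.
Proof. by rewrite -imp_neg_imp one_imp negK. Qed.

Lemma zero_imp_one : (0 : A) ~> 0^' = 0^'.
Proof. by rewrite -zero_imp_imp_one imp0 one_imp. Qed.

Lemma neg_imp_one x : x^' ~> 0^' = 0 ~> x.
Proof. by rewrite -[x^']imp0 imp_def zero_imp_one negK imp0 !negK. Qed.

Lemma imp_one x : x ~> 0^' = 0 ~> x^'.
Proof. by rewrite -neg_imp_one negK. Qed.

Lemma zero_imp_neg_zero_imp x : 0 ~> (0 ~> x)^' = 0 ~> x^'.
Proof. by rewrite -imp_one zero_imp_imp_one imp_one. Qed.

(** [zero_imp_neg_zero_imp] drops an inner prefix [0] that stands under a
    negation.  Used backwards for [(0 ~> x)^'] it supplies such a negation, and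
    two forward uses then remove the inner prefixes. *)
Lemma zero_imp_idem x : 0 ~> (0 ~> x) = 0 ~> x.
Proof.
rewrite -[0 ~> x in LHS]negK -[LHS]zero_imp_neg_zero_imp.
by rewrite (zero_imp_neg_zero_imp x) zero_imp_neg_zero_imp negK.
Qed.

(** * Implications with a repeated letter *)

(** Replace the inner [x] by [0^' ~> x]: the element becomes an instance of
    [imp_neg_imp] in which [0 ~> 0^'] is the unit. *)
Lemma imp_neg_self x : x ~> x^' = x^'.
Proof.
by rewrite -[LHS]negK -{2}[x]one_imp imp_neg_imp zero_imp_one one_imp.
Qed.

Lemma neg_imp_self x : x^' ~> x = x.
Proof. by rewrite -{2}[x]negK imp_neg_self negK. Qed.

(** Both sides are the value of [(y ~> (x ~> y)^')^']: one of the brackets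
    of the law is [y^' ~> y], which is [y]. *)
Lemma imp_imp_self x y : (y ~> x) ~> y = (0 ~> x) ~> y.
Proof. by rewrite imp_def neg_imp_self imp_neg_imp. Qed.

Lemma imp_neg_zero_imp x : x ~> (0 ~> x)^' = x^'.
Proof. by rewrite -neg_zero_imp_imp imp0 one_imp. Qed.

(** As [0 ~> x] is [x^' ~> 0^'], this is the law for [(0^' ~> y) ~> x]. *)
Lemma neg_imp_absorb x y : (0 ~> x) ~> (y ~> x)^' = (y ~> x)^'.
Proof. by rewrite -neg_imp_one -neg_imp_imp one_imp. Qed.

Lemma imp_imp_neg x y : (x ~> y) ~> y^' = y ~> (x ~> y)^'.
Proof.
by rewrite imp_def negK imp_neg_self negK imp_imp_self neg_zero_imp_imp.
Qed.

Lemma neg_zero_imp_imp_self x : (0 ~> x)^' ~> x = 0 ~> x.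
Proof.
have := imp_neg_imp (0 ~> x)^' x.
rewrite imp_neg_zero_imp negK imp_neg_self => /(f_equal neg).
by rewrite !negK.
Qed.

(** [imp_imp_neg] at the pair [x], [(0 ~> x)^'], where the implication
    [x ~> (0 ~> x)^'] is known to be [x^']. *)
Lemma neg_imp_zero_imp x : x^' ~> (0 ~> x) = 0 ~> x.
Proof.
have := imp_imp_neg x (0 ~> x)^'.
rewrite imp_neg_zero_imp !negK => ->.
by rewrite neg_zero_imp_imp_self.
Qed.

(** In the law the first bracket is [x^' ~> (0 ~> x)], that is [0 ~> x], and
    the second bracket absorbs it. *)
Lemma zero_imp_imp_imp x y : ((0 ~> x) ~> y) ~> x = y ~> x.
Proof. by rewrite imp_def neg_imp_zero_imp neg_imp_absorb negK. Qed.

Lemma imp_imp_neg_zero_imp x y : (x ~> y) ~> (0 ~> y)^' = (x ~> y)^'.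
Proof. by rewrite imp_def negK imp_neg_zero_imp negK zero_imp_imp_imp. Qed.

(** By [imp_imp_neg_zero_imp], [y ~> x] is itself the negation of an
    implication, now into [(0 ~> x)^'], so [neg_imp_absorb] applies to it. *)
Lemma zero_imp_neg_absorb x y : (0 ~> x^') ~> (y ~> x) = y ~> x.
Proof.
have := neg_imp_absorb (0 ~> x)^' (y ~> x).
by rewrite imp_imp_neg_zero_imp negK zero_imp_neg_zero_imp.
Qed.

Lemma neg_imp_one_imp x y : ((x ~> 0^') ~> y)^' = (0 ~> x) ~> y^'.
Proof. by rewrite neg_imp_imp one_imp imp_imp_self. Qed.

(** Both sides have the same negation, [(0 ~> x) ~> y^']: for the right side
    the bracket [y^' ~> y] of the law is [y]. *)
Lemma imp_one_imp x y : (x ~> 0^') ~> y = (x ~> y^') ~> y.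
Proof.
by rewrite [RHS]imp_def neg_imp_self imp_imp_self -neg_imp_one_imp negK.
Qed.

Lemma imp_imp_neg_imp x y :
  (x ~> (y ~> x^')) ~> x = x^' ~> (y ~> x^')^'.
Proof.
rewrite imp_def neg_imp_self -imp_one_imp imp_neg_imp imp_one.
by rewrite zero_imp_idem -imp_one -neg_zero_imp_imp -neg_imp_one_imp negK.
Qed.

(** * Absorption of negated consequents *)

(** The law does not distinguish [(0 ~> x)^'] from [0] in this position,
    because [(0 ~> x)^' ~> x] is [0 ~> x]. *)
Lemma imp_neg_zero_imp_imp x y : (y ~> (0 ~> x)^') ~> x = y^' ~> x.
Proof. by rewrite imp_def neg_zero_imp_imp_self -imp_def. Qed.

(** [imp_neg_zero_imp_imp] read three times: once backwards to expose the
    suffix [(0 ~> y)^'], then forwards for that suffix and for [y]. *)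
Lemma neg_imp_neg_zero_imp_imp x y :
  (x ~> (0 ~> y^')^')^' ~> y = x ~> y.
Proof.
rewrite -imp_neg_zero_imp_imp -zero_imp_neg_zero_imp.
by rewrite (imp_neg_zero_imp_imp (0 ~> y)^') imp_neg_zero_imp_imp negK.
Qed.

Lemma neg_zero_imp_neg_imp x y : ((0 ~> x^') ~> y)^' ~> x = y^' ~> x.
Proof.
rewrite -imp_neg_zero_imp_imp -zero_imp_neg_zero_imp zero_imp_imp_imp.
by rewrite imp_neg_zero_imp_imp.
Qed.

Lemma zero_imp_neg_imp_imp x y : (0 ~> (x ~> y)^') ~> y = (0 ~> x) ~> y.
Proof.
rewrite -imp_one [(x ~> y) ~> 0^']imp_def imp_one negK.
exact: neg_imp_neg_zero_imp_imp.
Qed.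

(** The negated factor is [(x ~> y) ~> y^'], so the left side has the shape
    treated by [imp_imp_self] and reduces to [zero_imp_neg_absorb]. *)
Lemma neg_zero_imp_imp_absorb x y :
  ((0 ~> x) ~> y)^' ~> (x ~> y) = x ~> y.
Proof.
by rewrite neg_zero_imp_imp -imp_imp_neg imp_imp_self zero_imp_neg_absorb.
Qed.

(** [neg_zero_imp_neg_imp] allows [y] to be inflated, under the negation, to
    [(0 ~> (x ~> y)^') ~> y]; this is [(0 ~> x) ~> y], for which absorption is
    [neg_zero_imp_imp_absorb]. *)
Lemma neg_imp_absorb_imp x y : y^' ~> (x ~> y) = x ~> y.
Proof.
rewrite -neg_zero_imp_neg_imp zero_imp_neg_imp_imp.
exact: neg_zero_imp_imp_absorb.
Qed.

(** The law for [((x ~> y) ~> 0) ~> y]: the first bracket collapses by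
    [neg_imp_absorb_imp]. *)
Lemma neg_imp_imp_self x y : (x ~> y)^' ~> y = x ~> y.
Proof.
rewrite -[(x ~> y)^']imp0 imp_def neg_imp_absorb_imp.
by rewrite imp_imp_neg_zero_imp negK.
Qed.

(** * Prefixes 0 *)

(** The bracket [(y ~> z)^' ~> z] of the law is [y ~> z], so what remains is
    an instance of [imp_neg_imp], in which the letter [z] of the left factor
    has disappeared. *)
Lemma imp_imp_imp_zero x y z : (z ~> x) ~> (y ~> z) = (0 ~> x) ~> (y ~> z).
Proof. by rewrite imp_def neg_imp_imp_self imp_neg_imp. Qed.

(** Negate, so that the left side becomes [(0 ~> y) ~> (x ~> (0 ~> y))^'];
    since [0 ~> y] is unchanged by a prefix [0], it is absorbed. *)
Lemma zero_imp_imp_zero_imp x y : (0 ~> x) ~> (0 ~> y) = x ~> (0 ~> y).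
Proof.
rewrite -[LHS]negK neg_zero_imp_imp -{1}zero_imp_idem.
by rewrite neg_imp_absorb negK.
Qed.

(** A negation under [0 ~> _] is an implication into [0^'], to which the
    law applies. *)
Lemma zero_imp_neg_neg_imp x y : 0 ~> (x^' ~> y)^' = x ~> (0 ~> y^').
Proof.
rewrite -imp_one imp_def imp_one negK -neg_imp_one_imp negK.
by rewrite neg_imp_one zero_imp_imp_zero_imp.
Qed.

(** Under [0 ~> _] the element [x ~> y] may be replaced by the negation of
    [0 ~> (x ~> y)^'], and then [zero_imp_neg_neg_imp] applies twice. *)
Lemma zero_imp_imp x y : 0 ~> (x ~> y) = x ~> (0 ~> y).
Proof.
rewrite -[x ~> y]negK -zero_imp_neg_zero_imp -{1}[x]negK.
by rewrite !zero_imp_neg_neg_imp zero_imp_neg_zero_imp negK.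
Qed.

Lemma zero_imp_zero_imp_imp x y : 0 ~> ((0 ~> x) ~> y) = 0 ~> (x ~> y).
Proof. by rewrite !zero_imp_imp zero_imp_imp_zero_imp. Qed.

(** The left side is the negation of [(0 ~> (y ~> z^')) ~> x]; moving the
    prefix [0] past [y] makes it the negation of [(y ~> (0 ~> z^')) ~> x], to
    which the law applies. *)
Lemma imp_neg_imp_imp x y z :
  x ~> ((y ~> z^') ~> x)^' = (x^' ~> y) ~> ((0 ~> z) ~> x^').
Proof.
rewrite -neg_zero_imp_imp zero_imp_imp neg_imp_imp.
by rewrite -imp_one neg_imp_one_imp.
Qed.

(** * Idempotence and its consequences *)

(** Two applications of the law at once.  The left side shortens when
    [y^' ~> u] absorbs [z], which says something about the product of the two
    implications on the right. *)
Lemma imp_imp_neg_def x y z u :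
  (z ~> (y^' ~> u)) ~> (x ~> y)^' = (((x ~> y) ~> z) ~> ((u ~> x) ~> y))^'.
Proof. by rewrite imp_def negK -imp_def. Qed.

(** For the chosen letters, the left side of [imp_imp_neg_def] contains
    [y ~> (x^' ~> y^')], where [y] is absorbed; what is left is the law for
    [(y ~> x)^']. *)
Lemma zero_imp_imp_imp_self x y :
  ((0 ~> x) ~> y) ~> (y ~> x) = y ~> x.
Proof.
have := imp_imp_neg_def 0 x y y^'.
rewrite -{1}[y]negK neg_imp_absorb_imp -neg_imp_imp imp0 negK.
by move=> /(f_equal neg); rewrite !negK => <-.
Qed.

(** Inserting [0 ~> (x ~> y)] by [zero_imp_imp_imp] turns the inner part into
    [(0 ~> y) ~> x], and [zero_imp_imp_imp_self] removes that. *)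
Lemma imp_idem x y : x ~> (x ~> y) = x ~> y.
Proof.
rewrite -[LHS]zero_imp_imp_imp zero_imp_imp imp_imp_self zero_imp_idem.
by rewrite zero_imp_imp_imp_self.
Qed.

Lemma zero_imp_imp_absorb x y : (0 ~> x) ~> (x ~> y) = x ~> y.
Proof.
rewrite -[RHS](zero_imp_imp_imp_self y x) -(imp_imp_self y x).
by rewrite (imp_imp_self x (x ~> y)).
Qed.

Lemma imp_imp_swap x y : (y ~> x) ~> (x ~> y) = x ~> y.
Proof. by rewrite imp_imp_imp_zero zero_imp_imp_absorb. Qed.

(** The law for [(y ~> 0) ~> _]; its two brackets are [x ~> y] and
    [0 ~> (x ~> y)], up to negation. *)
Lemma neg_imp_imp_neg_zero_imp x y :
  y^' ~> (x ~> (0 ~> y^')^') = x ~> y.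
Proof.
rewrite -[LHS]/((y ~> 0) ~> _) imp_def neg_imp_neg_zero_imp_imp.
by rewrite zero_imp_imp zero_imp_neg_zero_imp negK -zero_imp_imp
  imp_neg_zero_imp negK.
Qed.

(** With [t := x ~> (0 ~> y^')^'] one has [x ~> y = y^' ~> t] and
    [x^' ~> y^' = t ~> y^'], so this is [imp_imp_swap] for [t] and [y^']. *)
Lemma neg_imp_neg_imp_absorb x y : (x^' ~> y^') ~> (x ~> y) = x ~> y.
Proof.
rewrite -(neg_imp_imp_neg_zero_imp x y) -[x^' ~> y^']imp_neg_zero_imp_imp.
by rewrite imp_imp_swap.
Qed.

(** The law for [((x ~> y) ~> 0) ~> _]: its first bracket is [x ~> y] by
    [neg_imp_neg_imp_absorb], its second the negation of [0 ~> (x ~> y)]. *)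
Lemma neg_imp_neg_imp_neg x y : (x ~> y)^' ~> (x^' ~> y^')^' = x ~> y.
Proof.
rewrite -[LHS]/(((x ~> y) ~> 0) ~> _) imp_def negK neg_imp_neg_imp_absorb.
rewrite zero_imp_neg_neg_imp negK -zero_imp_imp imp_neg_zero_imp.
exact: negK.
Qed.

(** * Exchange of implications *)

(** The law for [(x^' ~> 0) ~> y^'] leaves the bracket [0 ~> y^'], which may be
    replaced by [0 ~> x^'] and is then absorbed by
    [imp_imp_neg_zero_imp]. *)
Lemma imp_neg_comm x y : 0 ~> x = 0 ~> y -> x ~> y^' = y ~> x^'.
Proof.
move=> eq0.
rewrite -{1}[x]negK -[LHS]/((x^' ~> 0) ~> _) imp_def negK.
rewrite -(zero_imp_neg_zero_imp y) -eq0 zero_imp_neg_zero_imp.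
by rewrite imp_imp_neg_zero_imp negK.
Qed.

(** Write [e = x ~> y], and let [p], [w] be the two factors of the left side
    [f = p ~> w].  Then [e = p ~> y] as well, and [e] and [f] both send [p] to
    itself.  As moreover [y^'] is absorbed by [f] and [w^'] by [e], the law for
    [(f ~> p) ~> y] and for [(e ~> p) ~> w] gives [f ~> e^' = e^'] and
    [e ~> f^' = f^']. *)
Lemma imp_imp_imp_imp_swap x y :
  ((x ~> y) ~> x) ~> ((y ~> x) ~> y) = x ~> y.
Proof.
rewrite (imp_imp_self y x) (imp_imp_self x y).
set e := x ~> y; set p := (0 ~> y) ~> x; set w := (0 ~> x) ~> y.
set f := p ~> w.
have e_p : e ~> p = p by rewrite /p -imp_imp_self imp_idem.
have p_y : p ~> y = e by rewrite zero_imp_imp_imp.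
have w0 : 0 ~> w = 0 ~> e by rewrite zero_imp_zero_imp_imp.
have f0 : 0 ~> f = 0 ~> e.
  rewrite /f zero_imp_imp w0 -zero_imp_imp.
  by rewrite /p /e zero_imp_imp_imp_self.
have f_p : f ~> p = p.
  by rewrite /f imp_imp_self w0 -[LHS]imp_imp_imp_zero imp_idem.
have w_e : w^' ~> e = e by rewrite neg_zero_imp_imp_absorb.
have w_f : w^' ~> f = f by rewrite neg_imp_absorb_imp.
have y_f : y^' ~> f = f.
  (* y^' may be inflated to (0 ~> f) ~> y^'; by f0 this is (0 ~> e) ~> y^',
     which is w^'. *)
  rewrite -zero_imp_imp_imp f0 -imp_imp_self.
  by rewrite neg_imp_absorb_imp imp_imp_neg -neg_zero_imp_imp w_f.
have f_e : f ~> e^' = e^' by have := neg_imp_imp f p y; rewrite f_p y_f p_y.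
have e_f : e ~> f^' = f^' by have := neg_imp_imp e p w; rewrite e_p w_e.
by rewrite -[f]negK -e_f -(imp_neg_comm _ _ f0) f_e negK.
Qed.

End InvolutiveImplicatorGroupoids.

Theorem lemma2p7 (A : algebra20) (hA : in_I20 A) :
  (* 1 *) (forall x y : A, (x ~> 0^') ~> y = (x ~> y^') ~> y) /\
  (* 2 *) (forall x : A, x ~> (0 ~> x)^' = x^') /\
  (* 3 *) (forall x y : A, (y ~> x) ~> y = (0 ~> x) ~> y) /\
  (* 4 *) (forall x y : A, ((x ~> 0^') ~> y)^' = (0 ~> x) ~> y^') /\
  (* 5 *) (forall x : A, 0 ~> x = 0 ~> (0 ~> x)) /\
  (* 6 *) (forall x y : A, (x^' ~> (0 ~> y))^' = (0 ~> x) ~> (0 ~> y)^') /\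
  (* 7 *) (forall x y : A, (x ~> (y ~> x)^')^' = (x ~> y) ~> x) /\
  (* 8 *) (forall x y : A, 0 ~> ((0 ~> x) ~> (0 ~> y^')^') = 0 ~> (x ~> y)) /\
  (* 9 *) (forall x y : A, 0 ~> ((0 ~> x) ~> y^') = x ~> (0 ~> y^')) /\
  (* 10 *) (forall x : A, 0 ~> (0 ~> x)^' = 0 ~> x^') /\
  (* 11 *) (forall x y : A, 0 ~> (x ~> y) = x ~> (0 ~> y)) /\
  (* 12 *) (forall x y : A,
    ((0 ~> x) ~> y) ~> x = ((y ~> x) ~> (0 ~> x)^')^') /\
  (* 13 *) (forall x y : A,
    (((0 ~> x) ~> y) ~> x)^' = (y ~> x) ~> (0 ~> x)^') /\
  (* 14 *) (forall x y : A, (0 ~> x^') ~> (y ~> x) = y ~> x) /\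
  (* 15 *) (forall x : A, x^' ~> (0 ~> x) = 0 ~> x) /\
  (* 16 *) (forall x y : A, (y ~> x)^' = (0 ~> x) ~> (y ~> x)^') /\
  (* 17 *) (forall x y : A, (x ~> y) ~> (0 ~> y)^' = (x ~> y)^') /\
  (* 18 *) (forall x y : A, 0 ~> (x^' ~> y)^' = x ~> (0 ~> y^')) /\
  (* 19 *) (forall x y : A,
    ((x ~> y) ~> x) ~> ((y ~> x) ~> y) = x ~> y) /\
  (* 20 *) (forall x y : A,
    (x ~> (y ~> x^')) ~> x = x^' ~> (y ~> x^')^') /\
  (* 21 *) (forall x y : A, x ~> (y ~> x^') = y ~> x^') /\
  (* 22 *) (forall x y : A, 0 ~> (x ~> y^')^' = 0 ~> (x^' ~> y)) /\
  (* 23 *) (forall x y : A, (x ~> y) ~> y^' = y ~> (x ~> y)^') /\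
  (* 24 *) (forall x y z : A,
    x ~> ((y ~> z^') ~> x)^' = (x^' ~> y) ~> ((0 ~> z) ~> x^')) /\
  (* 25 *) (forall x y z u : A,
    ((((x ~> 0^') ~> y) ~> z) ~> (u ~> ((0 ~> x) ~> y^'))^')^'
    = (z ~> u) ~> ((0 ~> x) ~> y^')) /\
  (* 26 *) (forall x y z : A,
    (z ~> x) ~> (y ~> z) = (0 ~> x) ~> (y ~> z)) /\
  (* 27 *) (forall x y z : A,
    (x^' ~> y) ~> ((0 ~> z) ~> x^') = (0 ~> y) ~> ((0 ~> z) ~> x^')) /\
  (* 28 *) (forall x y z : A,
    x ~> ((y ~> z^') ~> x)^' = (0 ~> y) ~> ((0 ~> z) ~> x^')) /\
  (* 29 *) (forall x y : A, (x^' ~> y) ~> (x ~> y^') = x ~> y^') /\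
  (* 30 *) (forall x y : A, (x ~> y^')^' ~> (x^' ~> y)^' = x ~> y^').
Proof.
split; first by move=> x y; apply: imp_one_imp.
split; first by move=> x; apply: imp_neg_zero_imp.
split; first by move=> x y; apply: imp_imp_self.
split; first by move=> x y; apply: neg_imp_one_imp.
split; first by move=> x; rewrite zero_imp_idem.
split.
  move=> x y; rewrite -neg_imp_one_imp // imp_one //.
  by rewrite zero_imp_imp_zero_imp.
split; first by move=> x y; rewrite imp_neg_imp // imp_imp_self.
split.
  move=> x y; rewrite zero_imp_zero_imp_imp // [LHS]zero_imp_imp //.
  by rewrite zero_imp_neg_zero_imp // negK // zero_imp_imp.
split.
  by move=> x y; rewrite zero_imp_zero_imp_imp // zero_imp_imp.
split; first by move=> x; apply: zero_imp_neg_zero_imp.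
split; first by move=> x y; apply: zero_imp_imp.
split.
  by move=> x y; rewrite imp_imp_neg_zero_imp // negK // zero_imp_imp_imp.
split.
  by move=> x y; rewrite imp_imp_neg_zero_imp // zero_imp_imp_imp.
split; first by move=> x y; apply: zero_imp_neg_absorb.
split; first by move=> x; apply: neg_imp_zero_imp.
split; first by move=> x y; rewrite neg_imp_absorb.
split; first by move=> x y; apply: imp_imp_neg_zero_imp.
split; first by move=> x y; apply: zero_imp_neg_neg_imp.
split; first by move=> x y; apply: imp_imp_imp_imp_swap.
split; first by move=> x y; apply: imp_imp_neg_imp.
split.
  move=> x y; rewrite -{1}(negK hA x); exact: neg_imp_absorb_imp.
split.
  move=> x y; rewrite -{1}(negK hA x) zero_imp_neg_neg_imp // negK //.
  by rewrite zero_imp_imp.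
split; first by move=> x y; apply: imp_imp_neg.
split; first by move=> x y z; apply: imp_neg_imp_imp.
split.
  by move=> x y z u; rewrite [RHS]imp_def // -neg_imp_one_imp // negK.
split; first by move=> x y z; apply: imp_imp_imp_zero.
split; first by move=> x y z; apply: imp_imp_imp_zero.
split.
  by move=> x y z; rewrite imp_neg_imp_imp // imp_imp_imp_zero.
split.
  by move=> x y; rewrite -{1}(negK hA y); apply: neg_imp_neg_imp_absorb.
by move=> x y; rewrite -{2}(negK hA y); apply: neg_imp_neg_imp_neg.
Qed.
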